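(* For every 3-edge-connected cubic graph $G$, the following holds: 1. If $C\subseteq G$ is a peripheral cycle, there exists a peripheral 2-base $B\subseteq E(G)$ with $E(C)\subseteq B$. 2. For every $r\in V(G)$, the graph $G-r$ has at least three peripheral 2-bases.
   Context: Graphs may have loops and parallel edges. A graph is $k$-edge-connected if it remains connected after deleting any set of fewer than $k$ edges. A graph is cubic if all degrees equal 3, and subcubic if all degrees are at most 3. $G-r$ is obtained by deleting the vertex $r$ and its incident edges; $G-S$ for $S\subseteq E(G)$ is obtained by deleting the edges of $S$ while keeping all vertices. In a subcubic graph $G=(V,E)$, an edge-set $S\subseteq E$ is peripheral if $G-S$ is connected; a subgraph $H\subseteq G$ is peripheral if $E(H)$ is peripheral. For a graph $G=(V,E)$, a positive integer $k$ and $S\subseteq E$, the $k$-closure $\langle S\rangle_k$ is the minimal edge-set $R$ with $S\subseteq R\subseteq E$ such that every cycle $C\subseteq G$ with $E(C)\setminus R\neq\emptyset$ has at least $k+1$ edges that are not in $R$. A set $S\subseteq E$ is a $k$-base of $G$ if $\langle S\rangle_k=E$. A peripheral 2-base of a graph is an edge-set of that graph which is both peripheral and a 2-base in it.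
   Formalization: Part 2 is stated only for graphs G with more than two vertices; this excludes exactly the graph with two vertices joined by three parallel edges, for which G−r has no edges and only one peripheral 2-base (the empty set). *)

(* Defs.v *)
From HB Require Import structures.
From mathcomp Require Import all_boot.
Set Implicit Arguments.
Unset Strict Implicit.
Unset Printing Implicit Defensive.

(* Finite multigraphs, with loops and parallel edges.  The graphs are
   undirected: each edge carries an arbitrary orientation, which no notion
   below depends on. *)
Record mgraph := MGraph {
  vert : finType;
  edge : finType;
  src : edge -> vert;
  tgt : edge -> vert
}.

Section Notions.
Variable G : mgraph.
Implicit Types (A C R S B : {set edge G}) (u v : vert G) (e : edge G) (k : nat).

Definition joins e u v : bool :=
  ((src e == u) && (tgt e == v)) || ((src e == v) && (tgt e == u)).

Definition incident e v : bool := (src e == v) || (tgt e == v).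

Definition adj A : rel (vert G) := fun u v => [exists e in A, joins e u v].

(* The degree of v in the subgraph with edge-set A; a loop counts twice. *)
Definition degree A v : nat :=
  #|[set e in A | src e == v]| + #|[set e in A | tgt e == v]|.

(* The spanning subgraph (V(G), A) is connected. *)
Definition connected A : bool := [forall u, forall v, connect (adj A) u v].

Definition cubic : bool := [forall v, degree setT v == 3].

Definition edge_connected k : Prop :=
  forall S, #|S| < k -> connected (~: S).

(* C is the edge-set of a cycle, i.e. of a connected 2-regular subgraph.  A
   cycle has no isolated vertices, so it is determined by its edge-set.  A loop
   is a cycle of length 1, and a pair of parallel edges one of length 2. *)
Definition is_cycle C : bool :=
  [&& C != set0,
      [forall v, [exists e in C, incident e v] ==> (degree C v == 2)] &
      [forall u, forall v,
        [exists e in C, incident e u] && [exists e in C, incident e v] ==>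
        connect (adj C) u v]].

Definition peripheral S : bool := connected (~: S).

Definition kclosed k R : bool :=
  [forall (C : {set edge G} | is_cycle C), (C :\: R != set0) ==> (k < #|C :\: R|)].

(* The k-closed sets are stable under intersection, so there is exactly one
   minimal k-closed set containing S; see kclosureP. *)
Definition kclosure k S : {set edge G} :=
  \bigcap_(R : {set edge G} | (S \subset R) && kclosed k R) R.

Definition kbase k S : bool := kclosure k S == setT.

Definition peripheral_kbase k B : bool := peripheral B && kbase k B.

Lemma kclosureP k S R :
  reflect (R = kclosure k S) (minset (fun R => (S \subset R) && kclosed k R) R).
Proof.
have sub (T : {set edge G}) : (S \subset T) && kclosed k T -> kclosure k S \subset T.
  by move=> hT; apply: bigcap_inf.
have clo : (S \subset kclosure k S) && kclosed k (kclosure k S).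
  apply/andP; split; first by apply/bigcapsP=> T /andP[].
  apply/'forall_implyP => C hC; apply/implyP => /set0Pn[e].
  rewrite inE => /andP[he eC].
  have [T hT eT] : exists2 T : {set edge G}, (S \subset T) && kclosed k T & e \notin T.
    apply/exists_inP; apply: contraR he => /exists_inPn h.
    by apply/bigcapP=> T /h; rewrite negbK.
  have /andP[_ /'forall_implyP/(_ C hC)/implyP h] := hT.
  apply: leq_trans (h _) (subset_leq_card (setDS _ (sub _ hT))).
  by apply/set0Pn; exists e; rewrite inE eT.
apply: (iffP minsetP) => [[hR hmin]|->].
  by rewrite (hmin _ clo) ?sub.
by split=> // T hT sT; apply/eqP; rewrite eqEsubset sT sub.
Qed.

End Notions.

(* Pitfall: if G consists of two vertices joined by three parallel edges, then
   G is cubic and 3-edge-connected, but G - r has no edges, so set0 is its only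
   edge-set and it has only one peripheral 2-base. *)
Definition del_vertex (G : mgraph) (r : vert G) : mgraph :=
  @MGraph {v : vert G | v != r}
          {e : edge G | (src e != r) && (tgt e != r)}
          (fun e => Sub (src (val e)) (proj1 (andP (valP e))))
          (fun e => Sub (tgt (val e)) (proj2 (andP (valP e)))).

(* Main.v *)
Require Import Defs.
From mathcomp Require Import all_boot zify.

(* Contracting the components of a 2-closed set R, two parallel edges of the
   quotient always lie in R.  So a set is a 2-base once these "double-edge
   merges", started from it, identify all vertices.  Given a merged set W and a
   rest X, a vertex of X with two edges to W merges for free.  If there is none,
   X contains a 2-edge-connected piece L with at most one edge leaving W and L.
   Choose T in L minimal with T and L - T connected and at least two vertices of
   T having an edge out of L: taking all edges inside T merges T with W, and
   minimality forces every vertex of T to have a neighbour in L - T, so that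
   deleting the edges inside T disconnects nothing.  For a peripheral cycle one
   starts from W = V(C); for G - r one first peels off such a T from G - r,
   avoiding one chosen neighbour of r.  This neighbour remains untouched, while
   the other two are covered, whence three different bases. *)

Set Implicit Arguments.
Unset Strict Implicit.
Unset Printing Implicit Defensive.

(** * Adjacency and connectivity through edge-sets *)

Lemma connect_stable (T : finType) (r : rel T) (D : {set T}) (x y : T) :
  (forall u v, u \in D -> r u v -> v \in D) -> x \in D -> connect r x y -> y \in D.
Proof.
move=> Dcl xD /connectP[p + ->]; elim: p x xD => //= z p IHp x xD /andP[xz].
exact: IHp (Dcl _ _ xD xz).
Qed.

Section Multigraph.
Variable G : mgraph.
Implicit Types (A B C P R : {set edge G}) (S T U W X L : {set vert G}).
Implicit Types (u v w x y z : vert G) (e f : edge G).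

Lemma joinsC e u v : joins e u v = joins e v u.
Proof. by rewrite /joins orbC. Qed.

Lemma joins_self e : joins e (src e) (tgt e).
Proof. by rewrite /joins !eqxx. Qed.

Lemma adjP A u v : reflect (exists2 e, e \in A & joins e u v) (adj A u v).
Proof. exact: exists_inP. Qed.

Lemma adj_sym A : symmetric (adj A).
Proof. by move=> u v; apply: eq_existsb => e; rewrite joinsC. Qed.

Lemma connect_adj_sym A : connect_sym (adj A).
Proof. exact/sym_connect_sym/adj_sym. Qed.

Lemma connect_adjS A B u v :
  A \subset B -> connect (adj A) u v -> connect (adj B) u v.
Proof.
move=> /subsetP AB; apply: connect_sub => x y /adjP[e eA exy].
by apply/connect1/adjP; exists e; rewrite ?AB.
Qed.

Lemma connect_joins A e u v : e \in A -> joins e u v -> connect (adj A) u v.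
Proof. by move=> eA euv; apply/connect1/adjP; exists e. Qed.

Lemma connect_adj_sub A B u v :
  (forall e, e \in A -> connect (adj B) (src e) (tgt e)) ->
  connect (adj A) u v -> connect (adj B) u v.
Proof.
move=> AB; apply: connect_sub => x y /adjP[e /AB eB].
by case/orP=> /andP[/eqP<- /eqP<-] //; rewrite connect_adj_sym.
Qed.

(** * Cycles and 2-closed sets *)

Lemma degreeU1 P e u v w : e \notin P -> joins e u v ->
  degree (e |: P) w = degree P w + (w == u) + (w == v).
Proof.
move=> eP euv.
have cardU (h : edge G -> vert G) :
    #|[set f in e |: P | h f == w]| = (w == h e) + #|[set f in P | h f == w]|.
  rewrite [w == h e]eq_sym; case: eqP => [hw|/eqP hw].
    rewrite (_ : [set f in _ | _] = e |: [set f in P | h f == w]) ?cardsU1 ?inE ?(negPf eP) //.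
    apply/setP=> f; rewrite !inE; case: (f =P e) => //= ->.
    by rewrite hw eqxx.
  rewrite add0n; congr #|pred_of_set _|; apply/setP=> f; rewrite !inE.
  by case: (f =P e) => //= ->; rewrite (negPf hw) (negPf eP).
rewrite /degree !cardU; case/orP: euv => /andP[/eqP<- /eqP<-]; lia.
Qed.

Lemma incident_degree A v : [exists e in A, incident e v] = (0 < degree A v).
Proof.
rewrite /degree addn_gt0 !card_gt0; apply/exists_inP/orP.
  case=> e eA /orP[] ev; [left|right]; apply/set0Pn; exists e; rewrite inE eA //.
by case=> /set0Pn[e]; rewrite inE => /andP[eA ev]; exists e; rewrite // /incident ev ?orbT.
Qed.

(** The degree equation covers both kinds of path: distinct ends are one short of degree 2, and on a
    trivial path they coincide in a vertex of degree 0. An edge joining the ends thus completes all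
    degrees to 2, even if it is a loop. *)
Lemma path_edges A x p : path (adj A) x p -> uniq (x :: p) ->
  exists P, [/\ P \subset A,
    forall v, degree P v + (v == x) + (v == last x p) = (v \in x :: p).*2 &
    forall v, v \in x :: p -> connect (adj P) x v].
Proof.
elim: p x => [|y p IHp] x /=.
  move=> _ _; exists set0; split=> [|v|v]; rewrite ?sub0set //; last first.
    by rewrite inE => /eqP->; apply: connect0.
  rewrite inE /degree (_ : [set e in set0 | _] = set0) ?cards0; last first.
    by apply/setP=> e; rewrite !inE.
  rewrite (_ : [set e in set0 | _] = set0) ?cards0; last first.
    by apply/setP=> e; rewrite !inE.
  lia.
move=> /andP[/adjP[e eA exy] pth] /andP[xp un].
have [P [PA dP cP]] := IHp y pth un.
have eP : e \notin P.
  apply/negP=> eP; have /eqP := dP x.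
  rewrite (negPf xp) addn_eq0 addn_eq0 -andbA => /andP[/eqP dx0 _].
  have : 0 < degree P x; last by rewrite dx0.
  rewrite -incident_degree; apply/exists_inP; exists e => //.
  by rewrite /incident; case/orP: exy => /andP[/eqP-> /eqP->]; rewrite eqxx ?orbT.
exists (e |: P); split=> [|v|v].
- by rewrite subUset sub1set eA.
- rewrite (degreeU1 v eP exy) [v \in x :: _]inE; have := dP v.
  case: (v =P x) => [->|_]; rewrite ?(negPf xp) ?orTb ?orFb => dv.
    by move: dv; clear; lia.
  by rewrite -dv !addn0.
- rewrite inE => /predU1P[->|/cP yv]; first exact: connect0.
  apply: connect_trans (connect_adjS (subsetUr _ _) yv).
  by apply: connect_joins exy; rewrite setU11.
Qed.

(** A repetition-free path in [A] is closed by [e]; the end terms in [path_edges] are exactly what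
    [degreeU1] adds. *)
Lemma connect_cycle A e u v : connect (adj A) u v -> e \notin A -> joins e u v ->
  exists C, [/\ is_cycle C, e \in C & C \subset e |: A].
Proof.
case/connectP=> p0 /shortenP[p pth un _] -> eA euv.
have [P [PA dP cP]] := path_edges pth un.
have eP : e \notin P by apply: contra eA; apply: subsetP.
have dC w : degree (e |: P) w = (w \in u :: p).*2.
  by rewrite (degreeU1 w eP euv) dP.
exists (e |: P); split; rewrite ?setU11 ?setUS //; apply/and3P; split.
- by apply/set0Pn; exists e; rewrite setU11.
- by apply/forallP=> w; rewrite incident_degree dC; case: (w \in _).
- apply/forallP=> w; apply/forallP=> w'; rewrite !incident_degree !dC.
  apply/implyP=> /andP[ww ww']; have PC : P \subset e |: P by apply: subsetUr.
  apply: connect_trans (connect_adjS PC (cP w' _)); last by case: (w' \in _) ww'.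
  by rewrite connect_adj_sym (connect_adjS PC) // cP //; case: (w \in _) ww.
Qed.

(** The cycle that [e] closes with [A] has at most [e] and the fewer than [k] edges of [A :\: R]
    outside [R], too few for a cycle not inside a [k]-closed set. *)
Lemma kclosed_edge k R A e u v : kclosed k R -> #|A :\: R| < k ->
  connect (adj A) u v -> joins e u v -> e \notin A -> e \in R.
Proof.
move=> /'forall_implyP Rcl Ak uv euv eA; apply/negPn/negP=> eR.
have [C [Cc eC CA]] := connect_cycle uv eA euv.
have /implyP/(_ _) := Rcl C Cc; rewrite ltnNge => /(_ _)/negP; apply.
  by apply/set0Pn; exists e; rewrite inE eR.
apply: leq_trans (_ : #|e |: (A :\: R)| <= k).
  apply/subset_leq_card/subsetP=> f; rewrite !inE => /andP[fR /(subsetP CA)].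
  by rewrite !inE fR.
by rewrite cardsU1; lia.
Qed.

(* The classes [c u = c v] play the role of the components of a 2-closed set
   inside [U]: two edges between the same two components lie in the closure. *)
Definition merging (K : Type) (c : vert G -> K) U :=
  forall e f u v u' v', e != f -> joins e u v -> joins f u' v' ->
    u \in U -> v \in U -> u' \in U -> v' \in U -> c u = c u' -> c v = c v' -> c u = c v.

(** If neither edge were in [R], then [e] would close a cycle inside [e |: (f |: R)], which has at
    most two edges outside [R]. *)
Lemma kclosed_merging R : kclosed 2 R -> merging (root (adj R)) setT.
Proof.
move=> Rcl e f u v u' v' ef euv fuv _ _ _ _.
move=> /(rootP (@connect_adj_sym R)) uu /(rootP (@connect_adj_sym R)) vv.
apply/(rootP (@connect_adj_sym R)).
case: (boolP (f \in R)) => fR.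
  apply: connect_trans uu (connect_trans (connect_joins fR fuv) _).
  by rewrite connect_adj_sym.
case: (boolP (e \in R)) => eR; first exact: connect_joins eR euv.
suff : e \in R by rewrite (negPf eR).
apply: (@kclosed_edge 2 R (f |: R) e u v) => //.
- rewrite setDUl setDv setU0; apply: leq_trans (_ : #|[set f]| < 2).
    by apply: subset_leq_card; apply: subsetDl.
  by rewrite cards1.
- have S := @connect_adjS R (f |: R) _ _ (subsetUr _ _).
  apply: connect_trans (S _ _ uu) _.
  apply: connect_trans (connect_joins (setU11 _ _) fuv) _.
  by rewrite connect_adj_sym S.
- by rewrite !inE negb_or ef eR.
Qed.

(** Applied to the components of a closed [R] containing [B], the hypothesis makes [R] connected,
    and [kclosed_edge] then puts every edge into [R]. Quantifying over all class maps [c] allows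
    those on [G - r] to be extended to [G] later. *)
Lemma kbase2P B :
  (forall (K : Type) (c : vert G -> K), merging c setT ->
     (forall e, e \in B -> c (src e) = c (tgt e)) -> forall u v, c u = c v) ->
  kbase 2 B.
Proof.
move=> Bc; rewrite /kbase eqEsubset subsetT; apply/bigcapsP=> R /andP[BR Rcl].
apply/subsetP=> e _; apply/negPn/negP=> eR; case/negP: (eR).
apply: (@kclosed_edge 2 R R e (src e) (tgt e)) => //.
- by rewrite setDv cards0.
- apply/(rootP (@connect_adj_sym R)); apply: Bc (kclosed_merging Rcl) _ _ _.
  move=> f fB; apply/(rootP (@connect_adj_sym R)).
  by apply: connect_joins (joins_self f); apply: (subsetP BR).
- exact: joins_self.
Qed.

End Multigraph.

Section Cuts.
Variable G : mgraph.
Implicit Types (S T U W X Y Z L : {set vert G}).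
Implicit Types (u v w x y z : vert G) (e f : edge G).

(** * Cuts and induced subgraphs *)

Definition cut X Y : {set edge G} :=
  [set e | (src e \in X) && (tgt e \in Y) || (src e \in Y) && (tgt e \in X)].

Definition induced S : {set edge G} := [set e | (src e \in S) && (tgt e \in S)].

Definition conn S : bool :=
  [forall x in S, forall y in S, connect (adj (induced S)) x y].

(* Locked, so that [inE] does not unfold membership in a component. *)
Definition component S x : {set vert G} :=
  locked [set y | connect (adj (induced S)) x y].

Lemma mem_component S x y : (y \in component S x) = connect (adj (induced S)) x y.
Proof. by rewrite /component -lock inE. Qed.

Lemma connP S : reflect {in S &, forall x y, connect (adj (induced S)) x y} (conn S).
Proof.
apply: (iffP forall_inP) => [h x y xS yS|h x xS].
  by have /forall_inP := h x xS; apply.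
by apply/forall_inP=> y yS; apply: h.
Qed.

Lemma mem_cut X Y e u v : joins e u v ->
  (e \in cut X Y) = (u \in X) && (v \in Y) || (u \in Y) && (v \in X).
Proof. by case/orP=> /andP[/eqP<- /eqP<-]; rewrite inE // orbC andbC [X in _ || X]andbC. Qed.

Lemma cutP X Y e :
  reflect (exists x y, [/\ x \in X, y \in Y & joins e x y]) (e \in cut X Y).
Proof.
apply: (iffP idP) => [|[x [y [xX yY exy]]]]; last by rewrite (mem_cut _ _ exy) xX yY.
rewrite inE => /orP[] /andP[xX yY]; first by exists (src e), (tgt e); rewrite joins_self.
by exists (tgt e), (src e); rewrite joinsC joins_self.
Qed.

Lemma mem_cut_joins X Y e x y : joins e x y -> x \in X -> y \in Y -> e \in cut X Y.
Proof. by move=> exy xX yY; apply/cutP; exists x, y. Qed.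

Lemma cutC X Y : cut X Y = cut Y X.
Proof. by apply/setP=> e; rewrite !inE orbC. Qed.

Lemma cutS X Y X' Y' : X \subset X' -> Y \subset Y' -> cut X Y \subset cut X' Y'.
Proof.
move=> /subsetP XX /subsetP YY; apply/subsetP=> e /cutP[x [y [xX yY exy]]].
by apply: mem_cut_joins exy _ _; [apply: XX|apply: YY].
Qed.

Lemma cutUr X Y Z : cut X (Y :|: Z) = cut X Y :|: cut X Z.
Proof.
apply/setP=> e; rewrite !inE.
by do ![case: (_ \in _)].
Qed.

Lemma card_cutUr X Y Z : [disjoint X & Y] -> [disjoint X & Z] -> [disjoint Y & Z] ->
  #|cut X (Y :|: Z)| = #|cut X Y| + #|cut X Z|.
Proof.
move=> XY XZ YZ; rewrite cutUr cardsU (_ : _ :&: _ = set0) ?cards0 ?subn0 //.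
apply/setP=> e; rewrite inE [in RHS]inE; apply/negbTE/negP=> /andP[/cutP[x [y [xX yY exy]]]].
rewrite (mem_cut _ _ exy) (disjointFr YZ yY) andbF /= => /andP[xZ _].
by rewrite (disjointFr XZ xX) in xZ.
Qed.

Lemma leq_card_cut X Y : #|cut X Y| <= \sum_(x in X) #|cut [set x] Y|.
Proof.
apply: leq_trans (_ : #|\bigcup_(x in X) cut [set x] Y| <= _).
  apply/subset_leq_card/subsetP=> e /cutP[x [y [xX yY exy]]].
  by apply/bigcupP; exists x => //; apply: mem_cut_joins exy _ yY; rewrite set11.
elim/big_rec2: _ => [|x m U _ IH]; first by rewrite cards0.
by apply: leq_trans (leq_card_setU _ _) _; rewrite leq_add2l.
Qed.

Lemma inducedS S T : S \subset T -> induced S \subset induced T.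
Proof.
move=> /subsetP ST; apply/subsetP=> e; rewrite !inE => /andP[/ST-> /ST->] //.
Qed.

Lemma mem_induced S e u v : joins e u v -> (e \in induced S) = (u \in S) && (v \in S).
Proof. by case/orP=> /andP[/eqP<- /eqP<-]; rewrite inE // andbC. Qed.

Lemma adj_inducedP S u v :
  reflect (exists e, [/\ joins e u v, u \in S & v \in S]) (adj (induced S) u v).
Proof.
apply: (iffP (adjP _ _ _)) => [[e eS euv]|[e [euv uS vS]]].
  by exists e; move: eS; rewrite (mem_induced _ euv) => /andP[].
by exists e; rewrite ?(mem_induced _ euv) ?uS.
Qed.

Lemma connect_induced S e u v :
  joins e u v -> u \in S -> v \in S -> connect (adj (induced S)) u v.
Proof. by move=> euv uS vS; apply/connect1/adj_inducedP; exists e. Qed.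

Lemma component_refl S x : x \in component S x.
Proof. by rewrite mem_component connect0. Qed.

Lemma component_sub S x : x \in S -> component S x \subset S.
Proof.
move=> xS; apply/subsetP=> y; rewrite mem_component => xy; apply: (connect_stable _ xS xy) => u v _.
by case/adj_inducedP=> e [].
Qed.

Lemma component_closed S x u v e :
  u \in component S x -> joins e u v -> u \in S -> v \in S -> v \in component S x.
Proof.
by rewrite !mem_component => xu euv uS vS; apply: connect_trans xu (connect_induced euv uS vS).
Qed.

Lemma component_connect S x y : x \in S -> y \in component S x ->
  connect (adj (induced (component S x))) x y.
Proof.
move=> xS; rewrite mem_component => xy.
suff : y \in [set y | (y \in component S x) && connect (adj (induced (component S x))) x y].
  by rewrite inE => /andP[].
apply: connect_stable xy; last by rewrite inE component_refl connect0.
move=> u v; rewrite inE => /andP[uC xu] /adj_inducedP[e [euv uS vS]].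
have vC := component_closed uC euv uS vS.
by rewrite inE vC (connect_trans xu) // (connect_induced euv).
Qed.

Lemma conn_from S x :
  (forall y, y \in S -> connect (adj (induced S)) x y) -> conn S.
Proof.
move=> h; apply/connP=> y z /h xy /h; apply: connect_trans.
by rewrite connect_adj_sym.
Qed.

Lemma conn_component S x : x \in S -> conn (component S x).
Proof. by move=> xS; apply: (@conn_from _ x) => y; apply: component_connect. Qed.

(** Induction along a connected set, the source of the inclusions in the peeling argument. *)
Lemma conn_closed T x (D : {set vert G}) : conn T -> x \in T -> x \in D ->
  (forall u v e, u \in D -> joins e u v -> u \in T -> v \in T -> v \in D) -> T \subset D.
Proof.
move=> /connP cT xT xD Dcl; apply/subsetP=> y yT.
apply: connect_stable xD (cT x y xT yT) => u v uD /adj_inducedP[e [euv uT vT]].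
exact: Dcl euv uT vT.
Qed.

Lemma edge_connected_cut k S : edge_connected G k ->
  S != set0 -> S != setT -> k <= #|cut S (~: S)|.
Proof.
move=> Gk /set0Pn[x xS] ST; rewrite leqNgt; apply/negP=> /Gk /forallP/(_ x)/forallP cx.
have /set0Pn[y] : ~: S != set0 by rewrite -setCT (inj_eq (@setC_inj _)).
rewrite inE => /negP; apply; apply: connect_stable xS (cx y) => u v uS /adjP[e].
rewrite inE => eS euv; apply: contraR eS => vS.
by apply: mem_cut_joins euv uS _; rewrite inE.
Qed.

(** Not an equality in general: a loop at [v] counts in [degree] but not in the cut. *)
Lemma cubic_cut v : cubic G -> #|cut [set v] (~: [set v])| <= 3.
Proof.
move=> /forallP/(_ v)/eqP<-; apply: leq_trans (leq_card_setU _ _).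
apply/subset_leq_card/subsetP=> e; rewrite !inE.
by case/orP=> /andP[]; rewrite ?orbT => ? ?; apply/orP; [left|right].
Qed.

End Cuts.

(** * Peeling a set off a 2-edge-connected piece *)

Section Cubic.
Variable G : mgraph.
Hypothesis deg3 : forall v : vert G, #|cut [set v] (~: [set v])| <= 3.
Hypothesis cut3 : forall S : {set vert G}, S != set0 -> S != setT -> 3 <= #|cut S (~: S)|.
Implicit Types (S T U W X Y Z L N : {set vert G}).
Implicit Types (u v w x y z : vert G) (e f : edge G).

Lemma deg_cut3 t X Y Z : t \notin X -> t \notin Y -> t \notin Z ->
  [disjoint X & Y] -> [disjoint X & Z] -> [disjoint Y & Z] ->
  #|cut [set t] X| + #|cut [set t] Y| + #|cut [set t] Z| <= 3.
Proof.
move=> tX tY tZ XY XZ YZ; rewrite -!card_cutUr ?disjoints1 //.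
- apply: leq_trans (deg3 t); apply/subset_leq_card/cutS => //.
  by rewrite subsetC sub1set !inE !negb_or tX tY.
- by rewrite !inE negb_or tX.
- by rewrite disjoint_sym -setI_eq0 setIUr setU_eq0 !setI_eq0 !(disjoint_sym Z) XZ.
Qed.

Lemma deg_cut2 t X Y : t \notin X -> t \notin Y -> [disjoint X & Y] ->
  #|cut [set t] X| + #|cut [set t] Y| <= 3.
Proof.
move=> tX tY XY; apply: leq_trans (leq_addr _ _) (deg_cut3 (Z := set0) tX tY _ XY _ _).
- by rewrite inE.
- by rewrite disjoint_sym disjoints_subset sub0set.
- by rewrite disjoint_sym disjoints_subset sub0set.
Qed.

Definition two_edge_connected L :=
  forall S, S \subset L -> S != set0 -> S != L -> 2 <= #|cut S (L :\: S)|.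

Definition exits L := [set z in L | cut [set z] (~: L) != set0].

Section PeelingOff.
Variable L : {set vert G}.
Hypotheses (L2 : two_edge_connected L) (L_gt1 : 1 < #|L|) (LT : L != setT).

(** 2-edge-connectivity keeps two of the at most three edges at [x] inside [L]. *)
Lemma exit_le1 x : x \in L -> #|cut [set x] (~: L)| <= 1.
Proof.
move=> xL; have : 2 <= #|cut [set x] (L :\ x)|.
  apply: L2; rewrite ?sub1set //; first by apply/set0Pn; exists x; rewrite set11.
  by apply: contraTneq L_gt1 => <-; rewrite cards1.
have : #|cut [set x] (L :\ x)| + #|cut [set x] (~: L)| <= 3; last by lia.
apply: deg_cut2; rewrite ?inE ?eqxx ?xL //.
by rewrite disjoints_subset setCK subsetDl.
Qed.

Lemma cut_exits S : S \subset L -> #|cut S (~: L)| <= #|exits L :&: S|.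
Proof.
move=> SL; apply: leq_trans (leq_card_cut _ _) _.
rewrite -sum1_card [X in _ <= X](eq_bigl (fun x => (x \in S) && (x \in exits L))); last first.
  by move=> x; rewrite inE andbC.
rewrite big_mkcondr /=; apply: leq_sum => x xS.
have xL := subsetP SL x xS; rewrite inE xL /=.
by case: eqP => [->|_]; rewrite ?cards0 ?exit_le1.
Qed.

(** At least three edges leave [L], and by [exit_le1] they start at different vertices. *)
Lemma exits_gt2 : 2 < #|exits L|.
Proof.
have := cut_exits (subxx L); rewrite (setIidPl _); last by apply/subsetP=> x; rewrite inE => /andP[].
by apply/leq_trans/cut3 => //; rewrite -card_gt0 ltnW.
Qed.

(** If [L :\ v] fell apart, each of two parts would need two edges to the rest of [L], all of them
    ending at [v]. That makes four edges at [v]. *)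
Lemma conn_del v : v \in L -> conn (L :\ v).
Proof.
move=> vL; have /card_gt0P[x xS] : 0 < #|L :\ v| by have := cardsD1 v L; rewrite vL; lia.
set K := component (L :\ v) x.
have KS : K \subset L :\ v by apply: component_sub.
have vK : v \notin K by apply/negP=> /(subsetP KS); rewrite !inE eqxx.
have cutv S : S \subset L :\ v -> S != set0 ->
    (forall u w e, u \in S -> joins e u w -> w \in L :\ v -> w \in S) ->
    2 <= #|cut [set v] S|.
  move=> SS S0 Scl; have vS : v \notin S by apply/negP=> /(subsetP SS); rewrite !inE eqxx.
  have SL : S \subset L by apply: subset_trans SS (subsetDl _ _).
  apply: leq_trans (L2 SL S0 _) _; first by apply: contraNneq vS => ->.
  rewrite cutC; apply/subset_leq_card/subsetP=> e /cutP[w [u [wL uS euw]]].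
  apply: (mem_cut_joins euw _ uS); move: wL; rewrite !inE => /andP[wS wL].
  by apply: contraNT wS => wv; apply: (Scl u w e); rewrite 1?joinsC // !inE wv.
have -> : L :\ v = K; last exact: conn_component.
apply/eqP; rewrite eqEsubset KS andbT -setD_eq0; apply/negPn/negP=> K'0.
have K2 : 2 <= #|cut [set v] K|.
  apply: cutv => //; first by apply/set0Pn; exists x; apply: component_refl.
  move=> u w e uK euw; move=> wL; exact: (component_closed uK euw (subsetP KS u uK) wL).
have K'2 : 2 <= #|cut [set v] ((L :\ v) :\: K)|.
  apply: cutv => //; first exact: subsetDl.
  move=> u w e; rewrite in_setD => /andP[uK uL] euw wL; rewrite in_setD wL andbT.
  apply: contra uK => wK; rewrite joinsC in euw.
  exact: (component_closed wK euw wL uL).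
have : #|cut [set v] K| + #|cut [set v] ((L :\ v) :\: K)| <= 3; last by lia.
apply: deg_cut2 => //; first by rewrite in_setD !inE eqxx andbF.
by rewrite disjoint_sym disjoints_subset; apply/subsetP=> z; rewrite in_setD in_setC => /andP[].
Qed.

(** [v] is a vertex to be spared: in [absorbing_exists] the only one in [L] that may have an edge
    out of [W :|: L], in [del_vertex_kbase] a chosen neighbour of [r]. *)
Definition peelable v T :=
  [&& T \subset L :\ v, conn T, conn (L :\: T) & 1 < #|exits L :&: T|].

(** Of the at least three exits of [L], removing [v] loses at most one. *)
Lemma peelable_del v : v \in L -> peelable v (L :\ v).
Proof.
move=> vL; apply/and4P; split=> //; first exact: conn_del.
  have -> : L :\: (L :\ v) = [set v].
    by apply/setP=> z; rewrite !inE; case: eqP => [->|_]; rewrite ?vL /= ?andNb.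
  by apply: (@conn_from _ _ v) => y; rewrite inE => /eqP->; apply: connect0.
have := exits_gt2; have -> : exits L :&: (L :\ v) = exits L :\ v.
  by apply/setP=> z; rewrite !inE; case: (z \in L); rewrite ?andbF ?andbT // andbC.
by rewrite (cardsD1 v); case: (v \in _) => /=; lia.
Qed.

(** By contradiction. By minimality, cutting [T] at a vertex of [F] leaves components with at most
    one exit each. The piece [N] of [x] in [T :\: F] has at least three outgoing edges, which leave
    [L] or end in [F]; counting exits in the components [K t], for the [t] in [F] attached to [N],
    excludes this. *)
Lemma minimal_peelable v T : v \in L -> minset (peelable v) T ->
  forall x, x \in T -> cut [set x] (L :\: T) != set0.
Proof.
move=> vL /minsetP[/and4P[TLv cT cLT exT] minT].
have TL : T \subset L by apply: subset_trans TLv (subsetDl _ _).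
have vT : v \notin T by apply/negP=> /(subsetP TLv); rewrite !inE eqxx.
set F := [set t in T | cut [set t] (L :\: T) != set0].
have FT : F \subset T by apply/subsetP=> t; rewrite inE => /andP[].
(* A component [K] with two exits would be a smaller peelable set: [L :\: K] is connected since
   [L :\: T] is, [t] has an edge to it, and the rest of [T] hangs on [t]. *)
have small t x : t \in F -> x \in T :\ t -> #|exits L :&: component (T :\ t) x| <= 1.
  move=> tF xTt; set K := component _ _; rewrite leqNgt; apply/negP=> exK.
  have KTt : K \subset T :\ t by apply: component_sub.
  have tK : t \notin K by apply/negP=> /(subsetP KTt); rewrite !inE eqxx.
  have KT : K \subset T by apply: subset_trans KTt (subsetDl _ _).
  have tT : t \in T by apply: (subsetP FT).
  suff /minT/(_ KT) KeqT : peelable v K by rewrite KeqT tT in tK.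
  apply/and4P; split; [exact: subset_trans KT TLv | exact: conn_component | | exact: exK].
  have : cut [set t] (L :\: T) != set0 by move: tF; rewrite inE => /andP[].
  case/set0Pn=> e /cutP[t' [w [/set1P-> wLT etw]]].
  have sub : L :\: T \subset L :\: K by apply: setDS.
  have wt : connect (adj (induced (L :\: K))) w t.
    by rewrite joinsC in etw; apply: (connect_induced etw); rewrite ?(subsetP sub w) // inE tK (subsetP TL).
  apply: (@conn_from _ _ w) => y; rewrite inE => /andP[yK yL].
  case: (boolP (y \in T)) => [yT|yT]; last first.
    apply: connect_adjS (inducedS sub) _.
    by apply: (connP _ cLT) => //; rewrite inE yT.
  suff /subsetP/(_ y yT) : T \subset K :|: [set z | connect (adj (induced (L :\: K))) w z].
    by rewrite in_setU (negPf yK) inE.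
  apply: (conn_closed cT tT); first by rewrite !inE wt orbT.
  move=> a b f; rewrite inE => Da fab aT bT; case: (boolP (a \in K)) => aK.
    case: (b =P t) => [->|/eqP bt]; first by rewrite !inE wt orbT.
    by rewrite inE (component_closed aK fab) // inE ?bT ?andbT // inE // (memPn tK).
  case: (boolP (b \in K)) => bK; first by rewrite inE bK.
  rewrite (negPf aK) /= inE in Da; rewrite inE (negPf bK) /= inE.
  by apply: connect_trans Da _; apply: (connect_induced fab _ _); rewrite inE ?aK ?bK (subsetP TL).
move=> x xT; apply: contraT => xF0.
have xF : x \notin F by rewrite inE xT.
set N := component (T :\: F) x.
have xTF : x \in T :\: F by rewrite inE xF.
have NTF : N \subset T :\: F by apply: component_sub.
have NT : N \subset T by apply: subset_trans NTF (subsetDl _ _).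
have NF z : z \in F -> z \notin N.
  by move=> zF; apply/negP=> /(subsetP NTF); rewrite inE zF.
set FN := [set t in F | cut [set t] N != set0].
pose K t := component (T :\ t) x.
have NK t : t \in F -> N \subset K t.
  move=> tF; apply/subsetP=> z; rewrite !mem_component; apply: connect_adjS.
  by apply/inducedS/setDS; rewrite sub1set.
have xTt t : t \in F -> x \in T :\ t by move=> tF; rewrite !inE xT andbT eq_sym (memPn xF).
have Kstep t a b e : t \in F -> a \in K t -> joins e a b -> b \in T -> b != t -> b \in K t.
  move=> tF aK eab bT bt; apply: (component_closed aK eab _ _); last by rewrite !inE bt.
  by apply: (subsetP (component_sub (xTt t tF))).
(* With two edges to [N] and one to [L :\: T], [t] has no further edge. So [t] is no exit and
   [t |: K t] is all of [T], which puts two exits into [K t]. *)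
have FN1 t : t \in FN -> #|cut [set t] N| <= 1.
  rewrite inE => /andP[tF tN]; rewrite leqNgt; apply/negP=> t2.
  have tT := subsetP FT t tF.
  have t1 : 0 < #|cut [set t] (L :\: T)| by rewrite card_gt0; move: tF; rewrite inE => /andP[].
  have tex : t \notin exits L.
    rewrite inE negb_and negbK -cards_eq0; apply/orP; right.
    have : #|cut [set t] N| + #|cut [set t] (L :\: T)| + #|cut [set t] (~: L)| <= 3; last first.
      by move: t1 t2; clear; lia.
    apply: deg_cut3; rewrite ?NF // ?inE ?tT ?(subsetP TL) //.
    - by rewrite disjoints_subset (subset_trans NT) // setDE setCI setCK subsetUr.
    - by rewrite disjoints_subset setCK (subset_trans NT).
    - by rewrite disjoints_subset setCK subsetDl.
  have tTN : cut [set t] ((T :\: N) :\ t) = set0.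
    apply/eqP; rewrite -cards_eq0.
    have : #|cut [set t] N| + #|cut [set t] (L :\: T)| + #|cut [set t] ((T :\: N) :\ t)| <= 3; last first.
      by move: t1 t2; clear; lia.
    apply: deg_cut3; rewrite ?NF // ?inE ?tT ?eqxx ?andbF //.
    - by rewrite disjoints_subset (subset_trans NT) // setDE setCI setCK subsetUr.
    - rewrite disjoints_subset; apply/subsetP=> z zN; rewrite !inE zN; by case: (_ == _).
    - rewrite disjoints_subset; apply/subsetP=> z; rewrite !inE => /andP[zT _].
      by rewrite (negPf zT) !andbF.
  have : T \subset t |: K t.
    apply: (conn_closed cT xT); first by rewrite in_setU1 component_refl orbT.
    move=> a b e; rewrite !in_setU1 => aD eab aT bT; case: eqP => //= /eqP bt.
    case/predU1P: aD => [at_|aK]; last exact: (Kstep t a b e).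
    apply/(subsetP (NK t tF))/negPn/negP=> bN.
    have : e \in cut [set t] ((T :\: N) :\ t).
      by apply: (mem_cut_joins eab _ _); rewrite !inE ?at_ ?bt ?bN.
    by rewrite tTN inE.
  move=> /subsetP TK; have := small t x tF (xTt t tF); rewrite leqNgt => /negP; apply.
  apply: leq_trans exT _; apply/subset_leq_card/subsetP=> z.
  rewrite !in_setI => /andP[zex /TK]; rewrite in_setU1 => /predU1P[zt|zK].
    by rewrite -zt zex in tex.
  by rewrite zex.
(* A walk in [T] from [x] can leave [K t] only at [t], which lies in [K t'], and vice versa. *)
have cover t t' : t \in FN -> t' \in FN -> t != t' -> T \subset K t :|: K t'.
  have nbK s s' : s \in FN -> s' \in FN -> s != s' -> s \in K s'.
    rewrite inE => /andP[sF /set0Pn[e /cutP[s0 [n [/set1P-> nN esn]]]]].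
    rewrite inE => /andP[s'F _] ss'; rewrite joinsC in esn.
    by apply: (Kstep s' n s e) => //; [apply: (subsetP (NK _ s'F))|apply: (subsetP FT)].
  move=> tFN t'FN tt'; have tK := nbK _ _ tFN t'FN tt'.
  have t'K : t' \in K t by apply: nbK; rewrite // eq_sym.
  have tF : t \in F by move: tFN; rewrite inE => /andP[].
  have t'F : t' \in F by move: t'FN; rewrite inE => /andP[].
  apply: (conn_closed cT xT); first by rewrite in_setU component_refl.
  move=> a b e aD eab aT bT; rewrite in_setU.
  case: (b =P t) => [->|/eqP bt]; first by rewrite tK orbT.
  case: (b =P t') => [->|/eqP bt']; first by rewrite t'K.
  move: aD; rewrite in_setU => /orP[] aK; first by rewrite (Kstep t a b e).
  by rewrite (Kstep t' a b e) // orbT.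
(* Every edge leaving [N] goes out of [L] or to a vertex of [FN], since vertices outside [F] have no
   neighbour in [L :\: T]. *)
have N3 : 3 <= #|exits L :&: N| + #|FN|.
  apply: leq_trans (cut3 (S := N) _ _) _.
  - by apply/set0Pn; exists x; apply: component_refl.
  - apply: contraNneq vT => NE; apply: (subsetP NT); by rewrite NE inE.
  apply: leq_trans (_ : #|cut N (~: L) :|: cut FN N| <= _).
    apply/subset_leq_card/subsetP=> e /cutP[a [b [aN bN eab]]]; rewrite inE.
    apply/orP; case: (boolP (b \in L)) => bL; last first.
      by left; apply: (mem_cut_joins eab aN _); rewrite inE.
    right; rewrite joinsC in eab; apply: (mem_cut_joins eab _ aN); rewrite joinsC in eab.
    have aTF := subsetP NTF a aN.
    have bT : b \in T.
      apply: contraTT aTF => bT; rewrite inE negb_and negbK inE.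
      rewrite (subsetP NT) //=; apply/orP; left; apply/set0Pn; exists e.
      by apply: (mem_cut_joins eab _ _); rewrite ?set11 // inE bT.
    have bF : b \in F.
      apply: contraLR bN => bF; rewrite inE negbK.
      by apply: (component_closed aN eab aTF _); rewrite inE bF.
    rewrite inE bF; apply/set0Pn; exists e; rewrite joinsC in eab.
    by apply: (mem_cut_joins eab _ aN); rewrite set11.
  apply: leq_trans (leq_card_setU _ _) _; apply: leq_add.
    by apply: cut_exits; apply: subset_trans NT TL.
  apply: leq_trans (leq_card_cut _ _) _; rewrite -sum1_card; exact: leq_sum.
have exK t : t \in FN -> #|exits L :&: K t| <= 1.
  by rewrite inE => /andP[tF _]; apply: small => //; apply: xTt.
have FNF t : t \in FN -> t \in F by rewrite inE => /andP[].
(* Otherwise [N] would be all of [T] and avoid [F], although 2-edge-connectivity gives an edge from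
   [T] to [L :\: T]. *)
have /card_gt0P[t0 t0FN] : 0 < #|FN|.
  rewrite card_gt0; apply/negP=> /eqP FN0.
  have T0 : T != set0 by apply/set0Pn; exists x.
  have TneL : T != L by apply: contraNneq vT => ->.
  have /card_gt0P[e /cutP[t [w [tT wLT etw]]]] := ltnW (L2 TL T0 TneL).
  have tF : t \in F.
    rewrite inE tT; apply/set0Pn; exists e; apply: (mem_cut_joins etw _ wLT); exact: set11.
  have : T \subset N.
    apply: (conn_closed cT xT); first exact: component_refl.
    move=> a b f aN fab aT bT; apply: contraT => bN.
    case: (boolP (b \in F)) => bF; last first.
      case/negP: bN; apply: (component_closed aN fab); first exact: (subsetP NTF).
      by rewrite in_setD bF.
    have : b \in FN.
      rewrite inE bF; apply/set0Pn; exists f; rewrite joinsC in fab.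
      by apply: (mem_cut_joins fab _ aN); rewrite set11.
    by rewrite FN0 inE.
  by move=> /subsetP/(_ t tT); apply/negP/NF.
have exN1 : #|exits L :&: N| <= 1.
  apply: leq_trans (exK _ t0FN); apply/subset_leq_card/setIS.
  exact/NK/FNF.
have /card_gt1P[t [t' [tFN t'FN tt']]] : 1 < #|FN| by move: N3 exN1; clear; lia.
(* [K t] and [K t'] cover [T] with at most one exit each, and an exit in [N] would lie in both. *)
have exN0 : #|exits L :&: N| = 0.
  have : #|exits L :&: T| <= #|(exits L :&: K t) :|: (exits L :&: K t')|.
    by rewrite -setIUr; apply/subset_leq_card/setIS/cover.
  rewrite cardsU; have : #|exits L :&: N| <= #|(exits L :&: K t) :&: (exits L :&: K t')|.
    by rewrite -setIIr; apply/subset_leq_card/setIS; rewrite subsetI !NK ?FNF.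
  by have := exK t tFN; have := exK t' t'FN; move: exT; clear; lia.
have /card_gt2P[t1 [t2 [t3 [[t1F t2F t3F] [t12 t23 t31]]]]] : 2 < #|FN| by move: N3; rewrite exN0.
(* Any two of [K t1], [K t2], [K t3] cover [T], so each of the exits [a] and [b] lies in at least
   two of them. These are four incidences, but each of the three sets holds at most one of [a] and
   [b]. *)
case/card_gt1P: exT => a [b [+ + ab]]; rewrite !in_setI => /andP[aex aT] /andP[bex bT].
have notboth s : s \in FN -> ~~ ((a \in K s) && (b \in K s)).
  move=> /exK/card_le1_eqP h; apply/negP=> /andP[aK bK]; case/eqP: ab.
  by apply: h; rewrite inE ?aex ?bex.
have cov s s' z : s \in FN -> s' \in FN -> s != s' -> z \in T -> (z \in K s) || (z \in K s').
  by move=> sF s'F ss' zT; have /subsetP/(_ z zT) := cover _ _ sF s'F ss'; rewrite inE.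
move: (notboth t1 t1F) (notboth t2 t2F) (notboth t3 t3F).
move: (cov _ _ _ t1F t2F t12 aT) (cov _ _ _ t2F t3F t23 aT) (cov _ _ _ t3F t1F t31 aT).
move: (cov _ _ _ t1F t2F t12 bT) (cov _ _ _ t2F t3F t23 bT) (cov _ _ _ t3F t1F t31 bT).
move: (a \in K t1) (a \in K t2) (a \in K t3) (b \in K t1) (b \in K t2) (b \in K t3).
by clear; do 6!case=> //=.
Qed.

Lemma peeling v : v \in L -> exists T,
  [/\ T \subset L :\ v, conn T, conn (L :\: T), 1 < #|exits L :&: T| &
      forall t, t \in T -> cut [set t] (L :\: T) != set0].
Proof.
move=> vL; have [T minT _] := minset_exists (peelable_del vL).
have /minsetP[/and4P[TL cT cLT exT] _] := minT.
by exists T; split=> //; apply: minimal_peelable minT.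
Qed.

End PeelingOff.
End Cubic.

(** * Absorbing the remaining vertices into a merged set *)

Lemma connect_class (G : mgraph) (K : Type) (c : vert G -> K) (A : {set edge G}) u v :
  (forall e, e \in A -> c (src e) = c (tgt e)) -> connect (adj A) u v -> c u = c v.
Proof.
move=> cA /connectP[p + ->]; elim: p u => //= w p IHp u /andP[/adjP[e /cA ce euw] /IHp<-].
by case/orP: euw => /andP[/eqP<- /eqP<-].
Qed.

Section Absorb.
Variable G : mgraph.
Hypothesis deg3 : forall v : vert G, #|cut [set v] (~: [set v])| <= 3.
Hypothesis cut3 : forall S : {set vert G}, S != set0 -> S != setT -> 3 <= #|cut S (~: S)|.
Implicit Types (S T U W X Y Z L N : {set vert G}).
Implicit Types (u v w x y z : vert G) (e f : edge G) (B : {set edge G}).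

(* [B] spans [X] from [W] in the sense of the 2-closure, deleting it does not
   disconnect anything, and it misses the vertices with a neighbour outside [W :|: X]. *)
Definition absorbing W X B :=
  [/\ B \subset induced X,
      forall e, e \in B -> connect (adj (induced X :\: B)) (src e) (tgt e),
      forall e v, e \in B -> incident e v -> cut [set v] (~: (W :|: X)) = set0 &
      forall (K : Type) (c : vert G -> K), merging c (W :|: X) ->
        {in W &, forall u v, c u = c v} -> (forall e, e \in B -> c (src e) = c (tgt e)) ->
        {in W :|: X &, forall u v, c u = c v}].

Lemma class_setU (K : Type) (c : vert G -> K) W X x w :
  {in W &, forall u v, c u = c v} -> {in X &, forall u v, c u = c v} ->
  x \in X -> w \in W -> c x = c w -> {in W :|: X &, forall u v, c u = c v}.
Proof.
move=> cW cX xX wW xw.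
have h u : u \in W :|: X -> c u = c w.
  by rewrite inE => /orP[uW|uX]; [apply: cW|rewrite (cX u x)].
by move=> u v /h-> /h->.
Qed.

(** The two edges from [x] to [W] already merge it with [W], so nothing is added to [B]. *)
Lemma absorbing_vertex W X x B : x \in X -> W != set0 -> 2 <= #|cut [set x] W| ->
  absorbing (W :|: [set x]) (X :\ x) B -> absorbing W X B.
Proof.
move=> xX /set0Pn[w wW] x2.
have WX : (W :|: [set x]) :|: (X :\ x) = W :|: X by rewrite -setUA setD1K.
have XS : X :\ x \subset X by apply: subsetDl.
case; rewrite WX => BX cB oB clB; split=> //.
- exact: subset_trans BX (inducedS XS).
- by move=> e /cB; apply/connect_adjS/setSD/inducedS.
move=> K c cm cW cBc; apply: clB => //.
have /card_gt1P[e [f [/cutP[x1 [a [/set1P-> aW exa]]] /cutP[x2' [b [/set1P-> bW fxb]]] ef]]] := x2.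
apply: (class_setU (x := x) (w := a)); rewrite ?set11 //; first by move=> u v /set1P-> /set1P->.
by apply: (cm e f x a x b) => //; rewrite ?inE ?xX ?aW ?bW ?orbT //; apply: cW.
Qed.

(** [induced T] makes [T] one class, and two exits of [T] give two edges to [W]: as [T] avoids [v],
    its edges out of [L] all end in [W]. For connectivity, both ends of an edge inside [T] have an
    edge to [L :\: T], whose connections survive by the detours around [B]. *)
Lemma absorbing_set W X L v T B : [disjoint W & X] -> L \subset X ->
  v \in L -> (forall u, u \in L -> u != v -> cut [set u] (~: (W :|: L)) = set0) ->
  T \subset L :\ v -> conn T -> conn (L :\: T) -> 1 < #|exits L :&: T| ->
  (forall t, t \in T -> cut [set t] (L :\: T) != set0) ->
  absorbing (W :|: T) (X :\: T) B -> absorbing W X (induced T :|: B).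
Proof.
move=> dWX LX vL vout TLv cT cLT exT Tadj.
have TL : T \subset L by apply: subset_trans TLv (subsetDl _ _).
have TX : T \subset X by apply: subset_trans TL LX.
have WX : (W :|: T) :|: (X :\: T) = W :|: X.
  apply/setP=> z; rewrite !inE; case zT: (z \in T); rewrite /= ?orbF //.
  by rewrite (subsetP TX z zT) !orbT.
have XS : X :\: T \subset X by apply: subsetDl.
have nv t : t \in T -> t != v by move=> /(subsetP TLv); rewrite !inE => /andP[].
have tout t : t \in T -> cut [set t] (~: (W :|: L)) = set0.
  by move=> tT; apply: vout (nv t tT); apply: (subsetP TL).
case; rewrite WX => BX cB oB clB.
have sub : induced (X :\: T) :\: B \subset induced X :\: (induced T :|: B).
  apply/subsetP=> e; rewrite !inE => /andP[eB /andP[/andP[sT sX] /andP[_ tX]]].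
  by rewrite (negPf sT) (negPf eB) sX tX.
split.
- by rewrite subUset inducedS // (subset_trans BX) // inducedS.
- move=> e; rewrite inE => /orP[|/cB]; last exact: connect_adjS.
  rewrite inE => /andP[sT tT].
  have step t : t \in T -> exists2 y, y \in L :\: T &
      connect (adj (induced X :\: (induced T :|: B))) t y.
    move=> tT'; have /set0Pn[f /cutP[t' [y [/set1P-> yLT fty]]]] := Tadj t tT'.
    (* [f] is not in [induced T], as [y] lies outside [T], nor in [B], which lives in [X :\: T]. *)
    exists y => //; apply: (connect_joins _ fty); move: (yLT); rewrite in_setD => /andP[yT yL].
    rewrite in_setD in_setU !(mem_induced _ fty) (negPf yT) andbF /=.
    rewrite (subsetP TX) // (subsetP LX) // andbT.
    by rewrite andbT; apply/negP=> /(subsetP BX); rewrite (mem_induced _ fty) in_setD tT'.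
  have [y yLT sy] := step _ sT; have [z zLT tz] := step _ tT.
  apply: connect_trans sy _; rewrite connect_adj_sym; apply: connect_trans tz _.
  apply: connect_adjS sub _; apply: connect_adj_sub (connP _ cLT z y zLT yLT).
  move=> f fLT; case: (boolP (f \in B)) => [/cB//|fB].
  apply: connect_joins (joins_self f); rewrite in_setD fB.
  exact: subsetP (inducedS (setSD _ LX)) _ fLT.
- move=> e z; rewrite inE => /orP[|/oB]; last exact.
  rewrite inE => /andP[sT tT] ez; have zT : z \in T by case/orP: ez => /eqP<-.
  apply/eqP; rewrite -subset0 -(tout z zT); apply: cutS => //.
  by rewrite setCS; apply: setUS.
move=> K c cm cW cBc; apply: clB => //; last by move=> e eB; apply: cBc; rewrite inE eB orbT.
have cTc : {in T &, forall u v, c u = c v}.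
  move=> a b aT bT; apply: connect_class (connP _ cT a b aT bT) => e eT.
  by apply: cBc; rewrite inE eT.
have toW z : z \in exits L :&: T -> exists e w, w \in W /\ joins e z w.
  rewrite in_setI inE => /andP[/andP[zL /set0Pn[e /cutP[z' [w [/set1P-> wL ezw]]]]] zT].
  exists e, w; split=> //; apply: contraT => wW; move: wL; rewrite inE => wL.
  have : e \in cut [set z] (~: (W :|: L)).
    by apply: (mem_cut_joins ezw); rewrite ?set11 // !inE negb_or wW.
  by rewrite tout ?inE.
have dW z : z \in T -> z \notin W by move=> zT; rewrite (disjointFl dWX) // (subsetP TX).
have /card_gt1P[a [b [aZ bZ ab]]] := exT.
have [e [w [wW eaw]]] := toW a aZ; have [f [w' [w'W fbw]]] := toW b bZ.
move: aZ bZ; rewrite !in_setI => /andP[_ aT] /andP[_ bT].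
apply: (class_setU (x := a) (w := w)) => //.
apply: (cm e f a w b w') => //; rewrite ?inE ?wW ?w'W ?(subsetP TX a aT) ?(subsetP TX b bT) ?orbT //; last exact: cW; last exact: cTc.
(* If the two edges coincided, then [a = b], because neither [a] nor [b] is in [W]. *)
apply: contraNneq ab => ef; rewrite -ef in fbw; apply/eqP.
case/orP: eaw => /andP[/eqP e1 /eqP e2]; case/orP: fbw => /andP[/eqP e3 /eqP e4].
- by rewrite -e1.
- by case/negP: (dW a aT); rewrite -e1 e3.
- by case/negP: (dW a aT); rewrite -e2 e4.
- by rewrite -e2.
Qed.

(** Induction on [#|X|], moving a vertex or a peeled set from [X] to [W]. The union [W :|: X] does
    not change, so the bound on the edges from [X] to its complement persists. *)
Lemma absorbing_exists W X : W != set0 -> [disjoint W & X] ->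
  #|cut X (~: (W :|: X))| <= 1 -> exists B, absorbing W X B.
Proof.
have [n] := ubnP #|X|; elim: n W X => // n IHn W X /ltnSE Xn W0 dWX X1.
have [->|X0] := eqVneq X set0.
  exists set0; rewrite /absorbing setU0; split=> //; first exact: sub0set.
  - by move=> e; rewrite inE.
  - by move=> e v; rewrite inE.
have sC S : cut (X :\: S) (~: ((W :|: S) :|: (X :\: S))) \subset cut X (~: (W :|: X)).
  apply: cutS; first exact: subsetDl.
  by rewrite setCS -setUA setUS //; apply/subsetP=> z zX; rewrite !inE zX andbT orbN.
have dS S : [disjoint W :|: S & X :\: S].
  rewrite -setI_eq0; apply/eqP/setP=> z; rewrite !inE.
  case zW: (z \in W); first by rewrite (disjointFr dWX zW) !andbF.
  by case: (z \in S).
case: (boolP [exists x in X, 2 <= #|cut [set x] W|]) => [/exists_inP[x xX x2]|/exists_inPn no2].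
  have [||||B aB] := IHn (W :|: [set x]) (X :\ x).
  - by move: Xn; rewrite (cardsD1 x) xX.
  - by apply: contraNneq W0 => WS; rewrite -subset0 -WS subsetUl.
  - exact: dS.
  - exact: leq_trans (subset_leq_card (sC _)) X1.
  by exists B; apply: absorbing_vertex aB.
pose few S := [&& S != set0, S \subset X & #|cut S (~: (W :|: S))| <= 1].
have fewX : few X by rewrite /few X0 subxx.
have [L /minsetP[/and3P[L0 LX L1] minL] _] := minset_exists fewX.
have dWL : [disjoint W & L] by apply: disjointWr LX dWX.
have LW z : z \in L -> z \notin W by move=> zL; rewrite (disjointFl dWL zL).
have L2 : two_edge_connected L.
  move=> S SL S0 SnL; rewrite leqNgt; apply/negP=> S1.
  (* By minimality of [L], a proper part with at most one edge to the rest of [L] has an edge out of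
     [W :|: L]. For [S] and [L :\: S] together these are two edges, against [L1]. *)
  have big S' : S' \subset L -> S' != set0 -> S' != L -> #|cut S' (L :\: S')| < 2 ->
      0 < #|cut S' (~: (W :|: L))|.
    move=> S'L S'0 S'nL S'1; rewrite lt0n; apply: contraNneq S'nL => c0.
    apply/eqP/minL => //; apply/and3P; split=> //; first exact: subset_trans LX.
    have -> : ~: (W :|: S') = (L :\: S') :|: ~: (W :|: L).
      apply/setP=> z; rewrite !inE; have := LW z; have := subsetP S'L z.
      by case: (z \in S'); case: (z \in L); case: (z \in W) => //= h1 h2; (have := h1 isT) || (have := h2 isT).
    by rewrite cutUr; apply: leq_trans (leq_card_setU _ _) _; rewrite c0 addn0 -ltnS.
  have h1 := big _ SL S0 SnL S1.
  have LDS : L :\: (L :\: S) = S by rewrite setDDr setDv set0U; apply/setIidPr.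
  have h2 : 0 < #|cut (L :\: S) (~: (W :|: L))|.
    apply: big; first exact: subsetDl.
    - rewrite setD_eq0; apply: contra SnL => LS; by rewrite eqEsubset SL.
    - apply: contraNneq S0 => E; by rewrite -LDS E setDv.
    - by rewrite LDS cutC.
  have := L1; rewrite -{1}(setID L S) (setIidPr SL) cutC card_cutUr.
  - by move: h1 h2; rewrite cutC [cut _ (L :\: S)]cutC; clear; lia.
  - by rewrite disjoint_sym disjoints_subset setCK (subset_trans SL) // subsetUr.
  - by rewrite disjoint_sym disjoints_subset setCK (subset_trans (subsetDl _ _)) // subsetUr.
  - by rewrite disjoint_sym disjoints_subset setDE subsetIr.
have LT : L != setT.
  by case/set0Pn: W0 => w wW; apply: contraTneq wW => LE; apply: LW; rewrite LE.
(* A single vertex would have at most one edge to [W] by [no2] and at most one to the outside by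
   [L1], against [cut3]. *)
have L_gt1 : 1 < #|L|.
  rewrite ltnNge; apply/negP=> Lle1.
  have /cards1P[x Lx] : #|L| == 1 by rewrite eqn_leq Lle1 card_gt0.
  have xL : x \in L by rewrite Lx set11.
  have := no2 x (subsetP LX x xL); have := cut3 L0 LT; rewrite Lx in L1 LW *.
  have -> : ~: [set x] = W :|: ~: (W :|: [set x]).
    apply/setP=> z; rewrite !inE; case zW: (z \in W) => //=.
    by apply: contraTneq zW => ->; apply: LW; rewrite set11.
  have := leq_card_setU (cut [set x] W) (cut [set x] (~: (W :|: [set x]))).
  by rewrite cutUr -leqNgt; move: L1; clear=> + [+ _]; lia.
(* [v] is the end in [L] of the only edge from [L] out of [W :|: L], or an arbitrary vertex of [L]
   if there is none. *)
have [v vL vout] : exists2 v, v \in L &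
    forall u, u \in L -> u != v -> cut [set u] (~: (W :|: L)) = set0.
  have [c0|/set0Pn[e ec]] := eqVneq (cut L (~: (W :|: L))) set0.
    case/set0Pn: L0 => v vL; exists v => // u uL _; apply/eqP; rewrite -subset0 -c0.
    by apply: cutS; rewrite ?sub1set.
  have /cutP[v [o [vL oO evo]]] := ec; exists v => // u uL.
  apply: contraNeq => /set0Pn[f fc].
  have fe : f = e.
    by apply: (card_le1_eqP L1) => //; apply: subsetP fc; apply: cutS; rewrite ?sub1set.
  move: fc; rewrite fe (mem_cut _ _ evo) => /orP[/andP[/set1P-> //]|].
  by rewrite !inE vL orbT.
have [T [TLv cT cLT exT Tadj]] := peeling deg3 cut3 L2 L_gt1 LT vL.
have TX : T \subset X by apply: subset_trans TLv (subset_trans (subsetDl _ _) LX).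
have [||||B aB] := IHn (W :|: T) (X :\: T).
- have : 0 < #|T| by apply: leq_trans (subset_leq_card (subsetIr (exits L) T)); apply: ltnW.
  by have := cardsID T X; rewrite (setIidPr TX); move: Xn; clear; lia.
- by apply: contraNneq W0 => WS; rewrite -subset0 -WS subsetUl.
- exact: dS.
- exact: leq_trans (subset_leq_card (sC _)) X1.
by exists (induced T :|: B); apply: (absorbing_set dWX LX vL vout TLv cT cLT exT Tadj aB).
Qed.

End Absorb.

(** * Extending a peripheral cycle *)

Section Main.
Variable G : mgraph.
Hypothesis Gcubic : cubic G.
Hypothesis G3 : edge_connected G 3.

(** Nothing lies outside [W :|: ~: W], so absorption applies with [W] the vertex set of [C]. The
    detours around [B] stay outside [W] and hence avoid [C]. *)
Lemma cycle_peripheral_kbase (C : {set edge G}) : is_cycle C -> peripheral C ->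
  exists B : {set edge G}, peripheral_kbase 2 B /\ C \subset B.
Proof.
move=> /and3P[/set0Pn[e eC] _ /forallP Cconn] Cper.
pose W := [set v | [exists f in C, incident f v]].
have WX : W :|: ~: W = setT by rewrite setUCr.
have [|||B [BX cB _ clB]] := @absorbing_exists G (fun v => cubic_cut v Gcubic)
    (fun S => @edge_connected_cut G 3 S G3) W (~: W).
- apply/set0Pn; exists (src e); rewrite inE; apply/exists_inP; exists e => //.
  by rewrite /incident eqxx.
- by rewrite disjoints_subset setCK.
- rewrite WX setCT (_ : cut _ _ = set0) ?cards0 //.
  by apply/setP=> f; rewrite !inE !andbF.
have XC : induced (~: W) \subset ~: C.
  apply/subsetP=> f; rewrite !inE => /andP[+ _]; apply: contra => fC.
  by apply/exists_inP; exists f => //; rewrite /incident eqxx.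
exists (C :|: B); split; last exact: subsetUl.
apply/andP; split.
  apply/forallP=> u; apply/forallP=> v.
  apply: connect_adj_sub (forallP (forallP Cper u) v) => f fC.
  case: (boolP (f \in B)) => fB; last first.
    apply: connect_joins (joins_self f); move: fC; by rewrite !inE negb_or fB => ->.
  by apply: connect_adjS (cB f fB); rewrite setCU setDE setSI.
apply: kbase2P => K c cm cCB u v; rewrite WX in clB.
apply: (clB K c cm _ _ u v (in_setT u) (in_setT v)) => [a b|f fB]; last first.
  by apply: cCB; rewrite inE fB orbT.
rewrite !inE => aW bW; apply: connect_class (_ : connect (adj C) a b).
  by move=> f fC; apply: cCB; rewrite inE fC.
by have /forallP/(_ b)/implyP := Cconn a; apply; rewrite aW.
Qed.

(** * Peripheral 2-bases after deleting a vertex *)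

Section Deletion.
Variable r : vert G.
Local Notation H := (del_vertex r).

Lemma edge_lift e : e \in induced (~: [set r]) -> exists e0 : edge H, val e0 = e.
Proof. by rewrite !inE => er; exists (Sub e er). Qed.

Lemma joins_val (e : edge H) (u v : vert H) : joins (val e) (val u) (val v) = joins e u v.
Proof. by []. Qed.

Lemma connect_val (A : {set edge G}) (u v : vert H) : A \subset induced (~: [set r]) ->
  connect (adj A) (val u) (val v) -> connect (adj [set e : edge H | val e \in A]) u v.
Proof.
move=> /subsetP Ar uv.
pose D := [set val w | w in [set w | connect (adj [set e : edge H | val e \in A]) u w]].
suff : val v \in D by case/imsetP=> w; rewrite inE => uw /val_inj->.
apply: connect_stable uv; last by apply: imset_f; rewrite inE connect0.
move=> _ y /imsetP[w + ->] /adjP[e eA ewy]; rewrite inE => uw.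
have yr : y != r.
  by have := Ar e eA; rewrite (mem_induced _ ewy) !inE => /andP[].
have [e0 e0e] := edge_lift (Ar e eA).
have -> : y = val (Sub y yr : vert H) by [].
apply: imset_f; rewrite inE; apply: connect_trans uw _.
by apply: (@connect_joins _ _ e0); rewrite ?inE -?joins_val e0e.
Qed.

(** [r] gets the value [None], which does not interfere since only edges avoiding [r] are compared.
    This makes absorption in [G] usable for [G - r]. *)
Lemma merging_del (K : Type) (c : vert H -> K) :
  merging c setT -> merging (fun u => omap c (insub u)) (~: [set r]).
Proof.
move=> cm e f u v u' v' ef euv fuv ur vr ur' vr'.
have lift x : x \in ~: [set r] -> exists x0 : vert H, val x0 = x.
  by rewrite !inE => xr; exists (Sub x xr).
have eI : e \in induced (~: [set r]) by rewrite (mem_induced _ euv) ur.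
have fI : f \in induced (~: [set r]) by rewrite (mem_induced _ fuv) ur'.
have [e0 Ee] := edge_lift eI; have [f0 Ef] := edge_lift fI.
have [u0 Eu] := lift u ur; have [v0 Ev] := lift v vr.
have [u1 Eu'] := lift u' ur'; have [v1 Ev'] := lift v' vr'.
rewrite -Eu -Ev -Eu' -Ev' !valK /= => -[cu] [cv]; congr Some.
apply: (cm e0 f0 u0 v0 u1 v1); rewrite ?inE -?joins_val ?Ee ?Ef ?Eu ?Ev ?Eu' ?Ev' //.
by apply: contraNneq ef => Eef; rewrite -Ee -Ef Eef.
Qed.

(** A counterpart of [cut_exits]: an edge out of [L] has only one end in [L], so picking such an
    edge at each exit is injective. *)
Lemma card_exits (L S : {set vert G}) : S \subset L ->
  #|exits L :&: S| <= #|cut S (~: L)|.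
Proof.
move=> /subsetP SL; pose pk z := [pick e in cut [set z] (~: L)].
have pkP z : z \in exits L :&: S -> exists2 e, pk z = Some e & e \in cut [set z] (~: L).
  rewrite !inE => /andP[/andP[_ /set0Pn[e0 e0z]] _]; rewrite /pk.
  by case: pickP => [e ez|/(_ e0)]; [exists e|rewrite e0z].
rewrite -(card_in_imset (f := pk)) => [|x y /pkP[e -> ex] yS]; last first.
  have [f -> fy [ef]] := pkP y yS; move: ex fy; rewrite -ef.
  case/cutP=> x' [a [/set1P-> aL exa]]; rewrite (mem_cut _ _ exa) => /orP[/andP[/set1P]//|].
  case/andP=> _ /set1P ay; move: yS; rewrite in_setI => /andP[_ /SL].
  by rewrite -ay => aL'; rewrite inE aL' in aL.
have Some_inj' : injective (@Some (edge G)) by move=> ? ? [].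
rewrite -(card_imset _ Some_inj'); apply/subset_leq_card/subsetP=> _ /imsetP[z zS ->].
have [e -> ez] := pkP z zS; apply: imset_f; apply: subsetP ez; apply: cutS => //.
by rewrite sub1set; move: zS; rewrite in_setI => /andP[].
Qed.

Lemma setC1_neqT : ~: [set r] != setT.
Proof. by apply/negP=> /eqP LE; have := in_setT r; rewrite -LE !inE eqxx. Qed.

Lemma card_setC1_gt1 : 2 < #|vert G| -> 1 < #|~: [set r]|.
Proof. by rewrite cardsC1 => V3; rewrite -ltnS prednK // (leq_trans _ V3). Qed.

(** The cuts of [S] and [L :\: S] in [G] have at least six edges together. At most three of these
    end at [r], and the others are counted twice, so twice the inner cut is at least 3 and the inner
    cut at least 2. *)
Lemma del_two_edge_connected : two_edge_connected (~: [set r]).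
Proof.
have deg3 w := cubic_cut w Gcubic.
have cut3 S := @edge_connected_cut G 3 S G3.
set L := ~: [set r]; have LT : L != setT := setC1_neqT; have CL : ~: L = [set r] by rewrite setCK.
move=> S SL S0 SnL.
have dSr : [disjoint S & [set r]] by rewrite disjoints_subset.
have dSL : [disjoint S & L :\: S] by rewrite disjoint_sym disjoints_subset setDE subsetIr.
have drL : [disjoint [set r] & L] by rewrite disjoints1 !inE eqxx.
have dr (U : {set vert G}) : U \subset L -> [disjoint [set r] & U] by move=> UL; apply: disjointWr UL drL.
have dDr : [disjoint L :\: S & [set r]] by rewrite disjoint_sym dr ?subsetDl.
have dDS : [disjoint L :\: S & S] by rewrite disjoint_sym.
have LS : ~: S = (L :\: S) :|: [set r].
  apply/setP=> z; rewrite !inE; case: eqP => [->|_]; rewrite ?andbT ?orbF ?andbF //=.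
  by apply/negP=> /(subsetP SL); rewrite !inE eqxx.
have LLS : ~: (L :\: S) = S :|: [set r] by rewrite setCD CL setUC.
have LS0 : L :\: S != set0 by rewrite setD_eq0; apply: contra SnL => LS'; rewrite eqEsubset SL.
have NT (U : {set vert G}) : U \subset L -> U != setT.
  by move=> UL; apply: contraNneq LT => UE; rewrite -subTset -UE.
have := cut3 S S0 (NT S SL); have := cut3 _ LS0 (NT _ (subsetDl L S)).
have := deg3 r; rewrite -/L -{1}(setID L S) (setIidPr SL).
rewrite LS LLS !card_cutUr ?dr ?subsetDl //.
rewrite ![cut _ [set r]]cutC [cut (L :\: S) S]cutC; clear; lia.
Qed.

(* The last property makes the bases for different choices of [v] different. *)
Lemma del_vertex_kbase v : 2 < #|vert G| -> v \in exits (~: [set r]) ->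
  exists2 B : {set edge H}, peripheral_kbase 2 B &
    forall z, z \in exits (~: [set r]) -> [exists e in B, incident (val e) z] = (z != v).
Proof.
move=> V3; set L := ~: [set r] => vex.
have deg3 w := cubic_cut w Gcubic.
have cut3 S := @edge_connected_cut G 3 S G3.
have L_gt1 : 1 < #|L| := card_setC1_gt1 V3.
have CL : ~: L = [set r] by rewrite setCK.
have LT : L != setT := setC1_neqT.
have L2 : two_edge_connected L := del_two_edge_connected.
have vL : v \in L by move: vex; rewrite inE => /andP[].
have [T [TLv cT cLT exT Tadj]] := peeling deg3 cut3 L2 L_gt1 LT vL.
have TL : T \subset L by apply: subset_trans TLv (subsetDl _ _).
have vT : v \notin T by apply/negP=> /(subsetP TLv); rewrite !inE eqxx.
have TX : T :|: (L :\: T) = L by rewrite -{1}(setIidPr TL) setID.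
have dTX : [disjoint T & L :\: T] by rewrite disjoint_sym disjoints_subset setDE subsetIr.
(* [T] takes at least two of the at most three edges at [r]. *)
have X1 : #|cut (L :\: T) (~: L)| <= 1.
  have := card_exits TL; have : #|cut [set r] T| + #|cut [set r] (L :\: T)| <= 3.
    by apply: deg_cut2; rewrite ?inE ?eqxx ?andbF //; apply/negP=> /(subsetP TL); rewrite !inE eqxx.
  rewrite CL ![cut _ [set r]]cutC; move: exT; clear; lia.
(* Absorption starts from [T] as merged set; that the edges inside [T] can be deleted too is shown
   below by means of [Tadj]. *)
have [|||B [BX cB outB clB]] := @absorbing_exists G deg3 cut3 T (L :\: T).
- by apply/set0Pn; have /card_gt1P[a [_ [+ _ _]]] := exT; rewrite in_setI => /andP[_ aT]; exists a.
- exact: dTX.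
- by rewrite TX.
rewrite TX in outB clB.
pose A := induced T :|: B.
have BL : B \subset induced L by apply: subset_trans BX (inducedS (subsetDl _ _)).
have AL : A \subset induced L by rewrite subUset inducedS.
exists [set e : edge H | val e \in A].
  apply/andP; split.
    have XA : induced (L :\: T) :\: B \subset induced L :\: A.
      apply/subsetP=> e; rewrite !inE => /andP[eB /andP[/andP[sT sX] /andP[_ tX]]].
      by rewrite (negPf sT) (negPf eB) sX tX.
    have vLT : v \in L :\: T by rewrite inE vT.
    have toLT y : y \in L :\: T -> connect (adj (induced L :\: A)) v y.
      move=> yLT; apply: connect_adj_sub (connP _ cLT v y vLT yLT) => f fLT.
      apply: connect_adjS XA _; case: (boolP (f \in B)) => [/cB//|fB].
      by apply: connect_joins (joins_self f); rewrite in_setD fB.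
    have toL y : y \in L -> connect (adj (induced L :\: A)) v y.
      move=> yL; case: (boolP (y \in T)) => yT; last by apply: toLT; rewrite inE yT.
      have /set0Pn[f /cutP[y' [w [/set1P-> wLT fyw]]]] := Tadj y yT.
      apply: connect_trans (toLT w wLT) _; rewrite joinsC in fyw.
      apply: (connect_joins _ fyw); move: wLT; rewrite in_setD => /andP[wT wL].
      rewrite in_setD in_setU !(mem_induced _ fyw) (negPf wT) wL yL /= andbT.
      by apply/negP=> /(subsetP BX); rewrite (mem_induced _ fyw) !in_setD yT andbF.
    apply/forallP=> a; apply/forallP=> b.
    have memL (z : vert H) : val z \in L by rewrite !inE (valP z).
    have : connect (adj (induced L :\: A)) (val a) (val b).
      by apply: connect_trans (toL _ (memL b)); rewrite connect_adj_sym toL.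
    move/(connect_val (subsetDl _ _)); apply: connect_adjS.
    by apply/subsetP=> e; rewrite !inE => /andP[].
  apply: kbase2P => K c cm cA a b.
  have cA' f : f \in A -> omap c (insub (src f)) = omap c (insub (tgt f)).
    move=> fA; have [f0 Ef] := edge_lift (subsetP AL f fA).
    have := cA f0; rewrite inE Ef => /(_ fA) cf; rewrite -Ef.
    by rewrite -[src (val f0)]/(val (src f0)) -[tgt (val f0)]/(val (tgt f0)) !valK /= cf.
  have memL (z : vert H) : val z \in L by rewrite !inE (valP z).
  have : omap c (insub (val a)) = omap c (insub (val b)).
    apply: (clB _ _ (merging_del cm)) => // [x y xT yT|f fB]; last first.
      by apply: cA'; rewrite inE fB orbT.
    apply: (@connect_class _ _ (fun u => omap c (insub u))) (connP _ cT x y xT yT) => f fT.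
    by apply: cA'; rewrite inE fT.
  by rewrite !valK => -[].
move=> z zex; have [->|zv] := eqVneq z v.
  (* Edges inside [T] miss [v], and [outB] keeps [B] away from all vertices with an edge to [r]. *)
  apply/exists_inP=> -[e]; rewrite inE in_setU => /orP[|eB ev].
    rewrite inE => /andP[sT tT] /orP[] /eqP E; by rewrite E (negPf vT) in sT tT.
  by move: vex; rewrite inE (outB _ _ eB ev) eqxx andbF.
have zL : z \in L by move: zex; rewrite inE => /andP[].
(* [v] is already an exit outside [T], and [X1] allows no second one. *)
have zT : z \in T.
  apply: contraT => zT; have := leq_trans (card_exits (subsetDl L T)) X1.
  rewrite leqNgt => /negP; case; apply/card_gt1P; exists z, v.
  by rewrite !in_setI zex vex !in_setD zT vT zL vL.
(* A second vertex of [T] forces, by connectedness, an edge of [induced T] at [z]. *)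
have [w wT wz] : exists2 w, w \in T & w != z.
  have /card_gt1P[a [b [+ + ab]]] := exT; rewrite !in_setI => /andP[_ aT] /andP[_ bT].
  by case: (eqVneq a z) => [az|]; [exists b; rewrite // -az eq_sym|exists a].
have /connectP[[|y p] /=] := connP _ cT z w zT wT; first by move=> _ wz'; rewrite wz' eqxx in wz.
case/andP=> /adj_inducedP[e [ezy _ yT]] _ _.
have eA : e \in A by rewrite inE (mem_induced _ ezy) zT yT.
have [e0 Ee] := edge_lift (subsetP AL e eA).
apply/exists_inP; exists e0; first by rewrite inE Ee.
rewrite Ee.
by rewrite /incident; case/orP: ezy => /andP[/eqP-> /eqP->]; rewrite eqxx ?orbT.
Qed.

(** By [exits_gt2], [r] has at least three neighbours; each is missed by its own base and covered by
    those of the others. *)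
Lemma del_vertex_three_kbases : 2 < #|vert G| ->
  3 <= #|[set B : {set edge H} | peripheral_kbase 2 B]|.
Proof.
move=> V3; have deg3 w := cubic_cut w Gcubic.
set L := ~: [set r].
have [v1 [v2 [v3 [[e1 e2 e3] [v12 v23 v31]]]]] : exists x y z : vert G,
    [/\ x \in exits L, y \in exits L & z \in exits L] /\ [/\ x != y, y != z & z != x].
  have cut3 S := @edge_connected_cut G 3 S G3.
  have L2 := del_two_edge_connected; have L1 := card_setC1_gt1 V3.
  exact/card_gt2P/(exits_gt2 deg3 cut3 L2 L1 setC1_neqT).
have [B1 b1 m1] := del_vertex_kbase V3 e1.
have [B2 b2 m2] := del_vertex_kbase V3 e2.
have [B3 b3 m3] := del_vertex_kbase V3 e3.
have neq (x y : vert G) (B B' : {set edge H}) : x \in exits L -> x != y ->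
    (forall z, z \in exits L -> [exists e in B, incident (val e) z] = (z != x)) ->
    (forall z, z \in exits L -> [exists e in B', incident (val e) z] = (z != y)) -> B != B'.
  move=> xe xy m m'; apply: contraNneq xy => BB.
  by apply: negbNE; rewrite -(m' x xe) -BB (m x xe) eqxx.
apply/card_gt2P; exists B1, B2, B3; rewrite !inE b1 b2 b3; split=> //.
by split; [apply: (neq v1 v2)|apply: (neq v2 v3)|apply: (neq v3 v1)].
Qed.

End Deletion.
End Main.

Theorem lemma7p2 (G : mgraph) (Gcubic : cubic G) (G3 : edge_connected G 3) :
  (forall C : {set edge G}, is_cycle C -> peripheral C ->
     exists B : {set edge G}, peripheral_kbase 2 B /\ C \subset B) /\
  (forall r : vert G, 2 < #|vert G| ->
     3 <= #|[set B : {set edge (del_vertex r)} | peripheral_kbase 2 B]|).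
Proof.
split=> [C|r]; first exact: cycle_peripheral_kbase.
exact: del_vertex_three_kbases.
Qed.
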